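(* Let $(G,H)$ be a matched pair of Lie groups with (reflexive) Lie algebras $\mathfrak g,\mathfrak h$. For a Hamiltonian function $\mathcal H=\mathcal H(\mu,\nu,g,h)$ on the right trivialized cotangent bundle $(\mathfrak g\bowtie\mathfrak h)^\ast\rtimes(G\bowtie H)$, Hamilton's equations are $$\begin{cases}\dfrac{dg}{dt}=TR_g\Big(\dfrac{\delta\mathcal H}{\delta\mu}\Big)+\dfrac{\delta\mathcal H}{\delta\nu}\triangleright g,\\[2mm]\dfrac{dh}{dt}=TR_h\Big(\dfrac{\delta\mathcal H}{\delta\nu}\triangleleft g\Big),\\[2mm]\dfrac{d\mu}{dt}=-T^\ast_{e_G}R_g\Big(\dfrac{\delta\mathcal H}{\delta g}\Big)+\mathrm{ad}^\ast_{\frac{\delta\mathcal H}{\delta\mu}}(\mu)+\mu\overset{\ast}{\triangleleft}\dfrac{\delta\mathcal H}{\delta\nu}+\mathfrak a^\ast_{\frac{\delta\mathcal H}{\delta\nu}}\nu,\\[2mm]\dfrac{d\nu}{dt}=-T^\ast_{e_H}\rho_g\Big(\dfrac{\delta\mathcal H}{\delta g}\Big)-g\overset{\ast}{\triangleright}T^\ast_{e_H}R_h\Big(\dfrac{\delta\mathcal H}{\delta h}\Big)+\mathrm{ad}^\ast_{\frac{\delta\mathcal H}{\delta\nu}}(\nu)+\dfrac{\delta\mathcal H}{\delta\mu}\overset{\ast}{\triangleright}\nu+\mathfrak b^\ast_{\frac{\delta\mathcal H}{\delta\mu}}\mu.\end{cases}$$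
   Context: A matched pair of Lie groups is a pair $(G,H)$ of Lie groups with a smooth left action $(h,g)\mapsto h\triangleright g$ of $H$ on the manifold $G$ and a smooth right action $(h,g)\mapsto h\triangleleft g$ of $G$ on the manifold $H$, such that $h\triangleright(g_1g_2)=(h\triangleright g_1)\big((h\triangleleft g_1)\triangleright g_2\big)$, $(h_1h_2)\triangleleft g=\big(h_1\triangleleft(h_2\triangleright g)\big)(h_2\triangleleft g)$, $h\triangleright e_G=e_G$, $e_H\triangleleft g=e_H$. The matched pair group $G\bowtie H$ is $G\times H$ with product $(g_1,h_1)(g_2,h_2)=\big(g_1(h_1\triangleright g_2),(h_1\triangleleft g_2)h_2\big)$. Lifted actions. With $\rho_g:H\to G$, $\rho_g(h)=h\triangleright g$; $\rho_h:G\to G$, $\rho_h(g)=h\triangleright g$; $\sigma_g:H\to H$, $\sigma_g(h)=h\triangleleft g$: put $\eta\triangleright g=T_{e_H}\rho_g(\eta)\in T_gG$, $h\triangleright\xi=T_{e_G}\rho_h(\xi)\in\mathfrak g$, $\eta\triangleleft g=T_{e_H}\sigma_g(\eta)\in\mathfrak h$. The Lie algebra actions are $\eta\triangleright\xi=\frac{d}{dt}\big|_{0}h_t\triangleright\xi\in\mathfrak g$ (for a curve $h_t$ with $h_0=e_H$, $\dot h_0=\eta$) and $\eta\triangleleft\xi=\frac{d}{dt}\big|_{0}\eta\triangleleft g_t\in\mathfrak h$ (for a curve $g_t$ with $g_0=e_G$, $\dot g_0=\xi$). The Lie algebra of $G\bowtie H$ is $\mathfrak g\bowtie\mathfrak h=\mathfrak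 g\oplus\mathfrak h$ with $[(\xi_1,\eta_1),(\xi_2,\eta_2)]=\big([\xi_1,\xi_2]+\eta_1\triangleright\xi_2-\eta_2\triangleright\xi_1,\,[\eta_1,\eta_2]+\eta_1\triangleleft\xi_2-\eta_2\triangleleft\xi_1\big)$, and $(\mathfrak g\bowtie\mathfrak h)^\ast=\mathfrak g^\ast\oplus\mathfrak h^\ast$ as a vector space. Dual maps, for $\xi\in\mathfrak g,\eta\in\mathfrak h,\mu\in\mathfrak g^\ast,\nu\in\mathfrak h^\ast,g\in G$: $\langle\mu\overset{\ast}{\triangleleft}\eta,\xi\rangle=\langle\mu,\eta\triangleright\xi\rangle$; $\langle\mathfrak b_\xi^\ast\mu,\eta\rangle=\langle\mu,\eta\triangleright\xi\rangle$; $\langle\xi\overset{\ast}{\triangleright}\nu,\eta\rangle=\langle\nu,\eta\triangleleft\xi\rangle$; $\langle\mathfrak a_\eta^\ast\nu,\xi\rangle=\langle\nu,\eta\triangleleft\xi\rangle$; $\langle g\overset{\ast}{\triangleright}\nu,\eta\rangle=\langle\nu,\eta\triangleleft g\rangle$. $R$ denotes right translation and $TR$ its tangent lift; $T^\ast_{e_G}R_g:T_g^\ast G\to\mathfrak g^\ast$, $T^\ast_{e_H}R_h:T_h^\ast H\to\mathfrak h^\ast$ and $T^\ast_{e_H}\rho_g:T^\ast_gG\to\mathfrak h^\ast$ are the duals of $T_{e_G}R_g$, $T_{e_H}R_h$, $T_{e_H}\rho_g$. For every Lie algebra, $\langle\mathrm{ad}^\ast_{x}m,y\rangle=-\langle m,[x,y]\rangle$;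 for every Lie group $K$, $\langle\mathrm{Ad}^\ast_k m,x\rangle=\langle m,\mathrm{Ad}_{k^{-1}}x\rangle$. Symplectic structure. $T^\ast(G\bowtie H)$ is identified with $(\mathfrak g\bowtie\mathfrak h)^\ast\rtimes(G\bowtie H)$ by right trivialization $\alpha_k\mapsto(T_e^\ast R_k\alpha_k,k)$, with group product $(m_1,k_1)(m_2,k_2)=(m_1+\mathrm{Ad}^\ast_{k_1}m_2,k_1k_2)$. Its right invariant vector fields are, for $(\hat\mu,\hat\nu)\in(\mathfrak g\bowtie\mathfrak h)^\ast$ and $(\xi,\eta)\in\mathfrak g\bowtie\mathfrak h$, $X_{(\hat\mu,\hat\nu,\xi,\eta)}(\mu,\nu,g,h)=\big((\hat\mu,\hat\nu)+\mathrm{ad}^\ast_{(\xi,\eta)}(\mu,\nu),\,TR_{(g,h)}(\xi,\eta)\big)$, and the canonical symplectic two-form $\Omega$ is determined by $\Omega(X_{(\hat\mu_1,\hat\nu_1,\xi_1,\eta_1)},X_{(\hat\mu_2,\hat\nu_2,\xi_2,\eta_2)})(\mu,\nu,g,h)=\langle(\hat\mu_2,\hat\nu_2),(\xi_1,\eta_1)\rangle-\langle(\hat\mu_1,\hat\nu_1),(\xi_2,\eta_2)\rangle+\langle(\mu,\nu),[(\xi_1,\eta_1),(\xi_2,\eta_2)]\rangle$. Hamilton's equations for $\mathcal H$ are the equations for integral curves of the vector field $X_{\mathcal H}$ with $i_{X_{\mathcal H}}\Omega=d\mathcal H$. The partial derivatives of $\mathcal H$ are $\frac{\delta\mathcal H}{\delta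 g}\in T^\ast_gG$, $\frac{\delta\mathcal H}{\delta h}\in T^\ast_hH$, and, by the reflexivity assumption $\mathfrak g^{\ast\ast}=\mathfrak g$, $\mathfrak h^{\ast\ast}=\mathfrak h$, $\frac{\delta\mathcal H}{\delta\mu}\in\mathfrak g$, $\frac{\delta\mathcal H}{\delta\nu}\in\mathfrak h$.
   Formalization: In the dμ/dt equation the terms μ◁*(δH/δν) and a*_{δH/δν}ν carry minus signs instead of the displayed plus signs, which contradict the given bracket and ad*; Lie groups are modelled on reflexive Banach spaces and the Hamiltonian is smooth. *)

(* Defs.v *)
From HB Require Import structures.
From mathcomp Require Import all_boot all_order all_algebra.
From mathcomp Require Import all_classical all_reals all_analysis.

Set Implicit Arguments.
Unset Strict Implicit.
Unset Printing Implicit Defensive.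

Import Order.TTheory GRing.Theory Num.Theory.
Import numFieldNormedType.Exports.

Local Open Scope classical_set_scope.
Local Open Scope ring_scope.

Section ContinuousDual.
Variables (R : realType) (E : normedModType R).

Definition continuous_functional : {pred E -> R} :=
  fun f => `[< linear f /\ continuous f >].

Record cdual := CDual {
  cdual_fun :> E -> R;
  cdualP : cdual_fun \in continuous_functional }.

HB.instance Definition _ := [isSub for cdual_fun].
HB.instance Definition _ := [Choice of cdual by <:].

Lemma cdual_linear (m : cdual) : linear m.
Proof. by have /asboolP[] := cdualP m. Qed.

Lemma cdual_continuous (m : cdual) : continuous m.
Proof. by have /asboolP[] := cdualP m. Qed.

HB.instance Definition _ (m : cdual) :=
  GRing.isLinear.Build R E R *:%R m (cdual_linear m).

Lemma continuous_functional_closed : subsemimod_closed continuous_functional.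
Proof.
split; first split.
- apply/asboolP; split; first by move=> a x y; rewrite /GRing.zero/= scaler0 addr0.
  exact: (@cst_continuous E R 0).
- move=> f g /asboolP[lf cf] /asboolP[lg cg]; apply/asboolP; split.
    by move=> a x y; rewrite !fctE lf lg scalerDr addrACA.
  by move=> x; apply: continuousD; [exact: cf | exact: cg].
- move=> a f /asboolP[lf cf]; apply/asboolP; split.
    move=> b x y; rewrite (_ : forall z, (a *: f) z = a *: f z)//.
    by rewrite lf scalerDr !scalerA mulrC.
  by move=> x; apply: continuousM; [exact: cst_continuous | exact: cf].
Qed.

HB.instance Definition _ := GRing.SubChoice_isSubLmodule.Build R (E -> R)
  continuous_functional cdual continuous_functional_closed.

Definition cdual_norm (m : cdual) : R := sup [set `|m x| | x in [set x | `|x| <= 1]].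

Let has_sup_norm (m : cdual) : has_sup [set `|m x| | x in [set x | `|x| <= 1]].
Proof.
split; first by exists `|m 0|, 0 => //=; rewrite normr0.
have /linear_bounded_continuous/bounded_funP/(_ 1)[M hM] := @cdual_continuous m.
by exists M => _ [x x1 <-]; exact: hM.
Qed.

Lemma cdual_norm_ub (m : cdual) (x : E) : `|m x| <= cdual_norm m * `|x|.
Proof.
have [->|x0] := eqVneq x 0; first by rewrite linear0 !normr0 mulr0.
have nx : 0 < `|x| by rewrite normr_gt0.
rewrite -ler_pdivrMr// -[X in _ / X]normr_id -normf_div.
have -> : m x / `|x| = m (`|x|^-1 *: x) by rewrite linearZ/= mulrC.
apply: ub_le_sup; first by case: (has_sup_norm m).
by exists (`|x|^-1 *: x) => //=; rewrite normrZ normfV normr_id mulVf// gt_eqF.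
Qed.

Let cdual_norm_le (m : cdual) (M : R) :
  (forall x, `|x| <= 1 -> `|m x| <= M) -> cdual_norm m <= M.
Proof.
move=> mM; apply: sup_le_ub; first by case: (has_sup_norm m).
by move=> _ [x x1 <-]; exact: mM.
Qed.

Let cdual_norm_ub1 (m : cdual) x : `|x| <= 1 -> `|m x| <= cdual_norm m.
Proof.
move=> x1; apply: ub_le_sup; first by case: (has_sup_norm m).
by exists x.
Qed.

Let cdual_norm_ge0 (m : cdual) : 0 <= cdual_norm m.
Proof. by apply: le_trans (@cdual_norm_ub1 m 0 _); rewrite ?normr0. Qed.

Let cdual_normD (m n : cdual) : cdual_norm (m + n) <= cdual_norm m + cdual_norm n.
Proof.
apply: cdual_norm_le => x x1.
by apply: le_trans (ler_normD (m x) (n x)) _; rewrite lerD// cdual_norm_ub1.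
Qed.

Let cdual_normZ_le (a : R) (m : cdual) :
  cdual_norm (a *: m) <= `|a| * cdual_norm m.
Proof.
apply: cdual_norm_le => x x1.
rewrite (_ : (a *: m) x = a * m x)// normrM ler_wpM2l//.
exact: cdual_norm_ub1.
Qed.

Let cdual_normZ (a : R) (m : cdual) : cdual_norm (a *: m) = `|a| * cdual_norm m.
Proof.
apply/eqP; rewrite eq_le cdual_normZ_le/=.
have [->|a0] := eqVneq a 0; first by rewrite normr0 mul0r cdual_norm_ge0.
rewrite -ler_pdivlMl ?normr_gt0// -normfV.
by apply: le_trans (cdual_normZ_le _ _); rewrite scalerK.
Qed.

Let cdual_norm0_eq0 (m : cdual) : cdual_norm m = 0 -> m = 0.
Proof.
move=> m0; apply/val_inj/funext => x; apply/eqP.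
by rewrite -normr_le0 (le_trans (cdual_norm_ub m x))// m0 mul0r.
Qed.

HB.instance Definition _ :=
  Lmodule_isNormed.Build R cdual cdual_normD cdual_normZ cdual_norm0_eq0.

(** [functional f] is [f] as an element of the dual, and the junk value [0]
    when [f] is not linear and continuous. *)
Definition functional (f : E -> R) : cdual := insubd 0 f.

Lemma functionalE (f : E -> R) :
  linear f -> continuous f -> functional f = f :> (E -> R).
Proof. by move=> lf cf; rewrite val_insubd ifT//; apply/asboolP. Qed.

End ContinuousDual.

Section Reflexivity.
Variables (R : realType) (E : normedModType R).

Definition bidual_eval (x : E) : cdual (cdual E) := functional (fun m : cdual E => m x).

Lemma bidual_evalE (x : E) (m : cdual E) : bidual_eval x m = m x.
Proof.
have lx : linear (fun m : cdual E => m x) by [].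
pose ex := HB.pack_for {linear cdual E -> R} (fun m : cdual E => m x)
  (GRing.isLinear.Build _ _ _ _ (fun m : cdual E => m x) lx).
rewrite /bidual_eval functionalE//.
apply: (@bounded_linear_continuous _ _ _ ex).
apply/bounded_funP => r; exists (r * `|x|) => n nr /=.
by apply: le_trans (cdual_norm_ub n x) _; rewrite ler_wpM2r.
Qed.

(** The canonical isometry of [E] into its bidual is onto; as duals are
    complete, this forces [E] to be a Banach space. *)
Definition is_reflexive := bijective bidual_eval.

(** The element of [E] identified with a functional on the dual of [E]. *)
Definition of_bidual (L : cdual (cdual E)) : E :=
  xget 0 [set x | bidual_eval x = L].

End Reflexivity.

(** [Cn n U f] says that the iterated tangent maps of [f], each of which sends
    [(x, v)] to [(f x, 'd f x v)], exist and are continuous over the open set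
    [U] up to order [n].  Only [forall n, Cn n U f] is used; it amounts to
    [f] being of class C^infty in the Frechet sense. *)
Fixpoint Cn (n : nat) (R : realType) (E F : normedModType R)
    (U : set E) (f : E -> F) : Prop :=
  if n is n'.+1 then
    (forall x, U x -> differentiable f x) /\
    Cn n' (U `*` setT) (fun p : E * E => 'd f (p.1) (p.2))
  else forall x, U x -> {for x, continuous f}.

Definition smooth_on (R : realType) (E F : normedModType R)
  (U : set E) (f : E -> F) : Prop := forall n, Cn n U f.

Record chart (R : realType) (E : normedModType R) (M : topologicalType) := Chart {
  dom : set M;
  fwd : M -> E;
  bwd : E -> M;
  dom_open : open dom;
  cod_open : open (fwd @` dom);
  fwdK : forall x, dom x -> bwd (fwd x) = x;
  fwd_continuous : forall x, dom x -> {for x, continuous fwd};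
  bwd_continuous : forall v, (fwd @` dom) v -> {for v, continuous bwd} }.

(** The atlas is the range of [chart_at].  The tangent space at [x] is the
    model space, a tangent vector being identified with its coordinates in the
    chart [chart_at x]. *)
Record chartedSpace (R : realType) (E : normedModType R) := ChartedSpace {
  point :> topologicalType;
  chart_at : point -> chart E point;
  chart_at_dom : forall x, dom (chart_at x) x }.

Definition is_manifold (R : realType) (E : normedModType R)
    (M : chartedSpace E) : Prop :=
  hausdorff_space M /\
  forall x y : M, smooth_on
    (fwd (chart_at x) @` (dom (chart_at x) `&` dom (chart_at y)))
    (fwd (chart_at y) \o bwd (chart_at x)).

Section Maps.
Variables (R : realType) (E F : normedModType R).
Variables (M : chartedSpace E) (N : chartedSpace F).

Definition in_charts (f : M -> N) (x : M) (y : N) : E -> F :=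
  fwd (chart_at y) \o f \o bwd (chart_at x).

Definition smooth_map (f : M -> N) : Prop :=
  continuous f /\
  forall x y, smooth_on
    (fwd (chart_at x) @` (dom (chart_at x) `&` f @^-1` dom (chart_at y)))
    (in_charts f x y).

Definition mdifferentiable (f : M -> N) (x : M) : Prop :=
  {for x, continuous f} /\
  differentiable (in_charts f x (f x)) (fwd (chart_at x) x).

(** The tangent map of [f] at [x], from the tangent space at [x] to the tangent
    space at [f x]. *)
Definition tmap (f : M -> N) (x : M) : E -> F :=
  'd (in_charts f x (f x)) (fwd (chart_at x) x).

End Maps.

Section VectorSpaceAsManifold.
Variables (R : realType) (V : normedModType R).

Fact id_continuous_at (x : V) : {for x, continuous (@id V)}.
Proof. by move=> A. Qed.

Fact setT_image_open : open (@id V @` [set: V]).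
Proof. by rewrite image_id; exact: openT. Qed.

Definition id_chart : chart V V :=
  @Chart R V V setT id id openT setT_image_open (fun _ _ => erefl)
    (fun x _ => id_continuous_at (x := x)) (fun x _ => id_continuous_at (x := x)).

Definition vect : chartedSpace V :=
  @ChartedSpace R V V (fun=> id_chart) (fun=> I).

End VectorSpaceAsManifold.

Section ProductManifold.
Variables (R : realType) (E F : normedModType R).

Section ProductChart.
Variables (M N : topologicalType) (c : chart E M) (d : chart F N).

Definition prod_fwd (p : M * N) : E * F := (fwd c p.1, fwd d p.2).
Definition prod_bwd (v : E * F) : M * N := (bwd c v.1, bwd d v.2).

Fact prod_image :
  prod_fwd @` (dom c `*` dom d) = (fwd c @` dom c) `*` (fwd d @` dom d).
Proof.
apply/seteqP; split => [_ [[x y] [/= cx dy] <-]|[u v] [/= [x cx <-] [y dy <-]]].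
  by split => /=; [exists x|exists y].
by exists (x, y).
Qed.

Fact open_setX (S T : topologicalType) (A : set S) (B : set T) :
  open A -> open B -> open (A `*` B).
Proof.
rewrite !openE => oA oB [x y] [/= Ax By]; exists (A, B) => //=.
by split; [exact: oA|exact: oB].
Qed.

Fact prod_continuous (S S' T T' : topologicalType) (f : S -> S') (g : T -> T')
    (p : S * T) :
  {for p.1, continuous f} -> {for p.2, continuous g} ->
  {for p, continuous (fun q : S * T => (f q.1, g q.2))}.
Proof.
move=> cf cg; apply: cvg_pair => /=.
  by apply: (@continuous_comp _ _ _ fst f) => //; exact: cvg_fst.
by apply: (@continuous_comp _ _ _ snd g) => //; exact: cvg_snd.
Qed.

Fact prod_cod_open : open (prod_fwd @` (dom c `*` dom d)).
Proof. by rewrite prod_image; apply: open_setX; exact: cod_open. Qed.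

Fact prod_fwdK p : (dom c `*` dom d) p -> prod_bwd (prod_fwd p) = p.
Proof. by case: p => x y [/= cx dy]; rewrite /prod_bwd/= !fwdK. Qed.

Fact prod_fwd_continuous p :
  (dom c `*` dom d) p -> {for p, continuous prod_fwd}.
Proof. by case=> cx dy; apply: prod_continuous; exact: fwd_continuous. Qed.

Fact prod_bwd_continuous v :
  (prod_fwd @` (dom c `*` dom d)) v -> {for v, continuous prod_bwd}.
Proof.
by rewrite prod_image => -[cx dy]; apply: prod_continuous; exact: bwd_continuous.
Qed.

Definition prod_chart : chart (E * F)%type (M * N)%type :=
  @Chart R (E * F)%type (M * N)%type _ _ _
    (open_setX (dom_open c) (dom_open d)) prod_cod_open
    prod_fwdK prod_fwd_continuous prod_bwd_continuous.

End ProductChart.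

Definition prod_space (M : chartedSpace E) (N : chartedSpace F) :
    chartedSpace (E * F)%type :=
  @ChartedSpace R (E * F)%type (M * N)%type
    (fun p => prod_chart (chart_at p.1) (chart_at p.2))
    (fun p => conj (chart_at_dom p.1) (chart_at_dom p.2)).

End ProductManifold.

(** Only the join of the two structures: continuity of the group operations is
    part of [lieGroup]. *)
#[short(type="groupSpaceType")]
HB.structure Definition GroupSpace := {G of Topological G & Group G}.

Record lieGroup (R : realType) (E : normedModType R) := LieGroup {
  lg_group :> groupSpaceType;
  lg_chart_at : lg_group -> chart E lg_group;
  lg_chart_at_dom : forall x, dom (lg_chart_at x) x;
  lg_space : chartedSpace E := ChartedSpace lg_chart_at_dom;
  lg_manifold : is_manifold lg_space;
  lg_mul_smooth : smooth_map (M := prod_space lg_space lg_space) (N := lg_space)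
    (fun p : lg_group * lg_group => (p.1 * p.2)%g);
  lg_inv_smooth : smooth_map (M := lg_space) (N := lg_space)
    (fun x : lg_group => (x^-1)%g) }.

Coercion lg_space : lieGroup >-> chartedSpace.

(** The Lie algebra of [G] is the model space [E], as the tangent space at the
    identity.  The bracket is the differential of the adjoint representation;
    this is the convention under which [mp_bracket] below is the bracket of the
    matched pair group. *)
Section LieAlgebra.
Variables (R : realType) (E : normedModType R) (G : lieGroup E).

Definition TR (g : G) (xi : E) : E :=
  tmap (M := G) (N := G) (fun x : G => (x * g)%g) 1%g xi.

Definition Ad (k : G) (xi : E) : E :=
  tmap (M := G) (N := G) (fun x : G => (k * x * k^-1)%g) 1%g xi.

Definition lie_bracket (xi eta : E) : E :=
  tmap (M := G) (N := vect E) (fun k : G => Ad k eta) 1%g xi.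

Definition ad_star (xi : E) (mu : cdual E) : cdual E :=
  functional (fun zeta => - mu (lie_bracket xi zeta)).

Definition coTR (g : G) (alpha : cdual E) : cdual E :=
  functional (fun xi => alpha (TR g xi)).

End LieAlgebra.

Record matchedPair (R : realType) (E F : normedModType R)
    (G : lieGroup E) (H : lieGroup F) := MatchedPair {
  lact : H -> G -> G;
  ract : H -> G -> H;
  lact_smooth : smooth_map (M := prod_space H G) (N := G)
    (fun p : H * G => lact p.1 p.2);
  ract_smooth : smooth_map (M := prod_space H G) (N := H)
    (fun p : H * G => ract p.1 p.2);
  lact1 : forall g, lact 1%g g = g;
  lactM : forall h1 h2 g, lact (h1 * h2)%g g = lact h1 (lact h2 g);
  ract1 : forall h, ract h 1%g = h;
  ractM : forall h g1 g2, ract h (g1 * g2)%g = ract (ract h g1) g2;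
  lact_mul : forall h g1 g2,
    lact h (g1 * g2)%g = (lact h g1 * lact (ract h g1) g2)%g;
  ract_mul : forall h1 h2 g,
    ract (h1 * h2)%g g = (ract h1 (lact h2 g) * ract h2 g)%g;
  lact_id : forall h, lact h 1%g = 1%g;
  ract_id : forall g, ract 1%g g = 1%g }.

Section MatchedPairDefs.
Variables (R : realType) (E F : normedModType R).
Variables (G : lieGroup E) (H : lieGroup F) (P : matchedPair G H).

(** [alg_lact_grp eta g] is [eta |> g], [grp_lact_alg h xi] is [h |> xi], and
    so on: the prefix tells where the actor on the left lives, the suffix where
    the argument on the right lives. *)

Definition alg_lact_grp (eta : F) (g : G) : E :=
  tmap (M := H) (N := G) (fun h : H => lact P h g) 1%g eta.

Definition grp_lact_alg (h : H) (xi : E) : E :=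
  tmap (M := G) (N := G) (lact P h) 1%g xi.

Definition alg_ract_grp (eta : F) (g : G) : F :=
  tmap (M := H) (N := H) (fun h : H => ract P h g) 1%g eta.

Definition alg_lact_alg (eta : F) (xi : E) : E :=
  tmap (M := H) (N := vect E) (fun h : H => grp_lact_alg h xi) 1%g eta.

Definition alg_ract_alg (eta : F) (xi : E) : F :=
  tmap (M := G) (N := vect F) (fun g : G => alg_ract_grp eta g) 1%g xi.

(** [mu <|* eta] *)
Definition lact_star (mu : cdual E) (eta : F) : cdual E :=
  functional (fun xi => mu (alg_lact_alg eta xi)).

Definition b_star (xi : E) (mu : cdual E) : cdual F :=
  functional (fun eta => mu (alg_lact_alg eta xi)).

(** [xi |>* nu] *)
Definition ract_star (xi : E) (nu : cdual F) : cdual F :=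
  functional (fun eta => nu (alg_ract_alg eta xi)).

Definition a_star (eta : F) (nu : cdual F) : cdual E :=
  functional (fun xi => nu (alg_ract_alg eta xi)).

(** [g |>* nu] *)
Definition grp_ract_star (g : G) (nu : cdual F) : cdual F :=
  functional (fun eta => nu (alg_ract_grp eta g)).

(** The dual of the tangent map at the identity of [h |-> h |> g]. *)
Definition corho (g : G) (alpha : cdual E) : cdual F :=
  functional (fun eta => alpha (alg_lact_grp eta g)).

Definition mp_space : chartedSpace (E * F)%type := prod_space G H.

Definition mp_mul (k l : G * H) : G * H :=
  ((k.1 * lact P k.2 l.1)%g, (ract P k.2 l.1 * l.2)%g).

Definition mp_TR (k : G * H) (x : E * F) : E * F :=
  tmap (M := mp_space) (N := mp_space) (fun l : G * H => mp_mul l k) (1%g, 1%g) x.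

Definition mp_bracket (x y : E * F) : E * F :=
  (lie_bracket G x.1 y.1 + alg_lact_alg x.2 y.1 - alg_lact_alg y.2 x.1,
   lie_bracket H x.2 y.2 + alg_ract_alg x.2 y.1 - alg_ract_alg y.2 x.1).

(** The dual of [E * F] is represented as [cdual E * cdual F]. *)
Definition mp_pairing (m : cdual E * cdual F) (x : E * F) : R :=
  m.1 x.1 + m.2 x.2.

Definition mp_functional (f : E * F -> R) : cdual E * cdual F :=
  (functional (fun xi => f (xi, 0)), functional (fun eta => f (0, eta))).

Definition mp_ad_star (x : E * F) (m : cdual E * cdual F) : cdual E * cdual F :=
  mp_functional (fun y => - mp_pairing m (mp_bracket x y)).

(** Values on [E] of the functional defining [mp_ad_star]: the component on
    [cdual E] of [mp_ad_star (xi, eta) (mu, nu)] is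
    [ad_star xi mu - lact_star mu eta - a_star eta nu]. *)
Lemma mp_ad_star_left (x : E * F) (m : cdual E * cdual F) (zeta : E) :
  - mp_pairing m (mp_bracket x (zeta, 0)) =
  - m.1 (lie_bracket G x.1 zeta) - m.1 (alg_lact_alg x.2 zeta)
  - m.2 (alg_ract_alg x.2 zeta).
Proof.
have Ad0 (k : H) : Ad (G := H) k 0 = 0 by rewrite /Ad/tmap linear0.
have br0 z : lie_bracket H z 0 = 0.
  rewrite /lie_bracket /tmap.
  have -> : (fun k : H => Ad (G := H) k 0) = cst 0 by apply/funext => k; rewrite Ad0.
  by rewrite /in_charts/= (_ : _ \o bwd _ = cst 0)// diff_cst.
have lact0 z : alg_lact_alg 0 z = 0 by rewrite /alg_lact_alg /tmap linear0.
have ract0 z : alg_ract_alg 0 z = 0.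
  rewrite /alg_ract_alg /tmap.
  have -> : (fun g : G => alg_ract_grp 0 g) = cst 0.
    by apply/funext => g; rewrite /alg_ract_grp /tmap linear0.
  by rewrite /in_charts/= (_ : _ \o bwd _ = cst 0)// diff_cst.
rewrite /mp_pairing /mp_bracket /= br0 lact0 ract0 add0r !subr0.
by rewrite opprD (linearD m.1)/= opprD.
Qed.

(** The right trivialized cotangent bundle, whose points are
    [((mu, nu), (g, h))], and its tangent spaces. *)
Definition cotangent : chartedSpace ((cdual E * cdual F) * (E * F))%type :=
  prod_space (vect (cdual E * cdual F)%type) mp_space.

Definition cotangent_vec : normedModType R := ((cdual E * cdual F) * (E * F))%type.

Definition right_invariant_field (m : cdual E * cdual F) (x : E * F)
    (p : cotangent) : cotangent_vec :=
  (m + mp_ad_star x p.1, mp_TR p.2 x).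

Definition two_form (Omega : cotangent -> cotangent_vec -> cotangent_vec -> R) :=
  forall p, [/\ forall v, linear (Omega p v : _ -> R^o),
                forall v, linear (Omega p ^~ v : _ -> R^o)
              & forall v, Omega p v v = 0].

Definition canonical_symplectic
    (Omega : cotangent -> cotangent_vec -> cotangent_vec -> R) :=
  two_form Omega /\
  forall m1 x1 m2 x2 (p : cotangent),
    Omega p (right_invariant_field m1 x1 p) (right_invariant_field m2 x2 p) =
    mp_pairing m2 x1 - mp_pairing m1 x2 + mp_pairing p.1 (mp_bracket x1 x2).

Section Hamiltonian.
Variable Ham : cotangent -> R^o.

(** [i_X Omega = d Ham] *)
Definition hamiltonian_field
    (Omega : cotangent -> cotangent_vec -> cotangent_vec -> R)
    (X : cotangent -> cotangent_vec) : Prop :=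
  forall p v, Omega p (X p) v = tmap (M := cotangent) (N := vect R^o) Ham p v.

Definition d_mu (mu : cdual E) (nu : cdual F) (g : G) (h : H) : E :=
  of_bidual (functional (tmap (M := vect (cdual E)) (N := vect R^o)
    (fun m => Ham ((m, nu), (g, h))) mu)).

Definition d_nu (mu : cdual E) (nu : cdual F) (g : G) (h : H) : F :=
  of_bidual (functional (tmap (M := vect (cdual F)) (N := vect R^o)
    (fun n => Ham ((mu, n), (g, h))) nu)).

Definition d_g (mu : cdual E) (nu : cdual F) (g : G) (h : H) : cdual E :=
  functional (tmap (M := G) (N := vect R^o) (fun x : G => Ham ((mu, nu), (x, h))) g).

Definition d_h (mu : cdual E) (nu : cdual F) (g : G) (h : H) : cdual F :=
  functional (tmap (M := H) (N := vect R^o) (fun y : H => Ham ((mu, nu), (g, y))) h).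

End Hamiltonian.

End MatchedPairDefs.

Section Curves.
Variables (R : realType) (E : normedModType R) (M : chartedSpace E).

Definition differentiable_curve (c : R^o -> M) (t : R) : Prop :=
  mdifferentiable (M := vect R^o) c t.

Definition velocity (c : R^o -> M) (t : R) : E :=
  tmap (M := vect R^o) c t 1.

Definition integral_curve (X : M -> E) (I : set R) (c : R^o -> M) : Prop :=
  forall t, I t -> differentiable_curve c t /\ velocity c t = X (c t).

End Curves.

(* Main.v *)
(** The right invariant fields [X_(m, x)] span every tangent space of the
    cotangent bundle, because [TR] of the matched pair group is block triangular
    with bijective diagonal blocks [TR g] and [eta |-> TR h (eta <| g)].  Testing
    [Omega (X_(m, x)) v = d Ham v] on [v = X_(m', x')], first with [x' = 0] and
    then with [m' = 0], forces [x = d Ham / d m] by reflexivity and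
    [m = - T^*R (d Ham / d k)] by antisymmetry of the bracket; the four equations
    are the components of [X_(m, x)] for these values.

    The dual maps take their intended values only where the functional defining
    them is linear and continuous.  For the brackets and the Lie algebra actions,
    which are mixed second derivatives of a C^2 map, this is read off the
    iterated tangent map. *)

From HB Require Import structures.
Require Import Defs.
From mathcomp Require Import all_boot all_order all_algebra.
From mathcomp Require Import all_classical all_reals all_analysis ring lra.
Import Order.TTheory GRing.Theory Num.Theory.
Import numFieldNormedType.Exports.
Local Open Scope classical_set_scope.
Local Open Scope ring_scope.
Set Implicit Arguments.
Unset Strict Implicit.
Unset Printing Implicit Defensive.

(** * Maps of class C^n between normed spaces *)

Section Calculus.
Variable R : realType.
Implicit Types E F K : normedModType R.

Lemma near_eq_is_diff E F (f g : E -> F) x df :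
  (\near x, f x = g x) -> is_diff x f df -> is_diff x g df.
Proof.
move=> fg [dif <-].
have gx : g x = f x by rewrite (nbhs_singleton fg).
suff H : g \o shift x = cst (g x) + 'd f x +o_ 0 id.
  have cf := diff_continuous dif.
  have e : 'd g x = 'd f x :> (E -> F) by exact: diff_unique.
  split; last exact: e.
  by apply/diff_locallyP; split; rewrite e; [exact: cf|exact: H].
apply/eqaddoP => e e0.
have /eqaddoP/(_ e e0) := diff_locally dif.
have : \forall h \near (0 : E), f (h + x) = g (h + x).
  by move: fg; rewrite (near_shift 0 x); apply: filterS => h; rewrite /= subr0.
apply: filterS2 => h /= fgh; rewrite !fctE /= gx /=.
by rewrite -fgh.
Qed.

Lemma Cn_near E F n (U : set E) (f g : E -> F) :
  open U -> (forall x, U x -> f x = g x) -> Cn n U f -> Cn n U g.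
Proof.
elim: n E F U f g => [|n IHn] E F U f g oU fg /=.
  move=> cf x Ux; have := cf x Ux.
  rewrite /prop_for /continuous_at -(fg x Ux); apply: cvg_trans; apply: near_eq_cvg.
  by apply: filterS (open_nbhs_nbhs (conj oU Ux)) => y /fg ->.
have nfg x : U x -> \near x, f x = g x.
  by move=> Ux; apply: filterS (open_nbhs_nbhs (conj oU Ux)) => y /fg.
have dfg x : U x -> is_diff x f ('d f x) -> is_diff x g ('d f x).
  by move=> Ux; apply: near_eq_is_diff; exact: nfg.
move=> [df Cf]; split=> [x Ux|].
  by case: (dfg _ Ux (differentiableP (df _ Ux))).
apply: IHn Cf => [|[x v] [/= Ux _]]; first exact: open_setX openT.
by have [_ ->] := dfg _ Ux (differentiableP (df _ Ux)).
Qed.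

Lemma Cn_subset E F n (U V : set E) (f : E -> F) :
  U `<=` V -> Cn n V f -> Cn n U f.
Proof.
elim: n E F U V f => [|n IHn] E F U V f UV /= => [cf x /UV|[df Cf]]; first exact: cf.
split=> [x /UV|]; first exact: df.
by apply: IHn Cf => -[x v] [/= /UV].
Qed.

Lemma Cn_pred E F n (U : set E) (f : E -> F) : Cn n.+1 U f -> Cn n U f.
Proof.
elim: n E F U f => [|n IHn] E F U f /= [df Cf].
  by move=> x /df /differentiable_continuous.
by split=> //; exact: IHn.
Qed.

Lemma Cn_linear E F n (U : set E) (f : {linear E -> F}) :
  open U -> continuous f -> Cn n U f.
Proof.
elim: n E F U f => [|n IHn] E F U f oU cf /=; first by move=> x _; exact: cf.
split=> [x _|]; first exact: linear_differentiable.
have lf : linear (fun p : E * E => f p.2) by move=> a x y /=; rewrite linearP.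
pose f2 := HB.pack_for {linear (E * E)%type -> F} (fun p : E * E => f p.2)
  (GRing.isLinear.Build _ _ _ _ _ lf).
apply: (Cn_near (f := f2)).
- exact: open_setX openT.
- by move=> -[x v] _ /=; rewrite diff_lin.
- apply: IHn => [|p]; first exact: open_setX openT.
  by apply: (continuous_comp (f := snd) (g := f)); [exact: cvg_snd|exact: cf].
Qed.

Lemma Cn_pair E F K n (U : set E) (f : E -> F) (g : E -> K) : open U ->
  Cn n U f -> Cn n U g -> Cn n U (fun x => (f x, g x)).
Proof.
elim: n E F K U f g => [|n IHn] E F K U f g oU /=.
  by move=> cf cg x Ux; apply: cvg_pair; [exact: cf|exact: cg].
move=> [df Cf] [dg Cg]; split=> [x Ux|].
  by apply: differentiable_pair; [exact: df|exact: dg].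
apply: Cn_near (IHn _ _ _ _ _ _ _ Cf Cg); try exact: open_setX openT.
by move=> [x v] [/= Ux _]; rewrite diff_pair//; [exact: df|exact: dg].
Qed.

Lemma Cn_comp E F K n (U : set E) (V : set F) (f : E -> F) (g : F -> K) :
  open U -> open V -> (forall x, U x -> V (f x)) ->
  Cn n U f -> Cn n V g -> Cn n U (g \o f).
Proof.
elim: n E F K U V f g => [|n IHn] E F K U V f g oU oV UV.
  by move=> /= cf cg x Ux; apply: continuous_comp; [exact: cf|exact: (cg _ (UV _ Ux))].
move=> Cf' /= [dg Cg]; have [/= df Cf] := Cf'; split=> [x Ux|].
  by apply: differentiable_comp; [exact: df|exact/dg/UV].
have oUT : open (U `*` [set: E]) by exact: open_setX openT.
have Cfst : Cn n (U `*` [set: E]) (f \o fst).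
  apply: (IHn _ _ _ _ U) => //; first by move=> x [].
    by apply: (@Cn_linear _ _ _ _ fst) => // p; exact: cvg_fst.
  exact: Cn_pred Cf'.
apply: Cn_near (IHn _ _ _ _ _ _ _ oUT (open_setX oV openT) _ (Cn_pair oUT Cfst Cf) Cg) => //.
  by move=> [x v] [/= Ux _]; rewrite (diff_comp (df _ Ux) (dg _ (UV _ Ux))).
by move=> [x v] [/= /UV].
Qed.

Lemma Cn_continuous E F n (U : set E) (f : E -> F) x :
  Cn n U f -> U x -> {for x, continuous f}.
Proof. by elim: n => [cf Ux|n IHn /Cn_pred]; [exact: cf|exact: IHn]. Qed.

Definition Cn_at n E F (f : E -> F) (x : E) : Prop :=
  exists U : set E, [/\ open U, U x & Cn n U f].

Lemma Cn_at_near n E F (f g : E -> F) x :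
  (\near x, f x = g x) -> Cn_at n f x -> Cn_at n g x.
Proof.
move=> fgx [U [oU Ux Cf]].
have : nbhs x [set y | f y = g y] by [].
rewrite nbhsE => -[V [oV Vx] fg].
exists (U `&` V); split; [exact: openI|by []|].
apply: (Cn_near (f := f)); [exact: openI|by move=> y [_ /fg]|].
exact: Cn_subset Cf.
Qed.

Lemma Cn_at_pair n E F K (f : E -> F) (g : E -> K) x :
  Cn_at n f x -> Cn_at n g x -> Cn_at n (fun y => (f y, g y)) x.
Proof.
move=> [U [oU Ux Cf]] [V [oV Vx Cg]].
exists (U `&` V); split; [exact: openI|by []|].
by apply: Cn_pair; [exact: openI|exact: Cn_subset Cf|exact: Cn_subset Cg].
Qed.

Lemma open_preimage_within (S T : topologicalType) (U : set S) (V : set T) (f : S -> T) :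
  open U -> open V -> (forall x, U x -> {for x, continuous f}) ->
  open (U `&` f @^-1` V).
Proof.
move=> oU oV cf; rewrite openE => x [Ux Vfx].
apply: filterI; first exact: open_nbhs_nbhs.
by apply: (cf x Ux); exact: open_nbhs_nbhs.
Qed.

Lemma Cn_at_comp n E F K (f : E -> F) (g : F -> K) x :
  Cn_at n f x -> Cn_at n g (f x) -> Cn_at n (g \o f) x.
Proof.
move=> [U [oU Ux Cf]] [V [oV Vfx Cg]].
have oW : open (U `&` f @^-1` V).
  by apply: open_preimage_within => // y; exact: Cn_continuous Cf.
exists (U `&` f @^-1` V); split => //.
apply: Cn_comp oW oV _ _ Cg; first by move=> y [].
exact: Cn_subset Cf.
Qed.

Lemma Cn_at_linear n E F (f : {linear E -> F}) x : continuous f -> Cn_at n f x.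
Proof.
by move=> cf; exists setT; split=> [||];
  [exact: openT| |exact/Cn_linear/cf/openT].
Qed.

Definition tangent E F (f : E -> F) (p : E * E) : F := 'd f (p.1) (p.2).

Section MixedPartial.
Variables (E F K : normedModType R) (phi : E * F -> K) (U : set (E * F)).
Variables (u0 : E) (y0 : F).
Hypotheses (oU : open U) (U0 : U (u0, y0)) (C2 : Cn 2 U phi).

Let partial (w : F) (u : E) : K := 'd (fun y => phi (u, y)) y0 w.

Let partialE u : U (u, y0) ->
  is_diff y0 (fun y => phi (u, y)) (fun w => 'd phi (u, y0) (0, w)).
Proof.
move=> Uu; have [/= dphi _] := C2.
have dpair : is_diff y0 (fun y => (u, y)) (fun w => (0, w)).
  exact: (is_diff_pair (is_diff_cst u y0) (is_diff_id y0)).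
have := is_diff_comp dpair (differentiableP (dphi _ Uu)).
exact.
Qed.

Let nearU : \forall u \near u0, U (u, y0).
Proof.
have : {for u0, continuous (fun u => (u, y0))}.
  by apply: cvg_pair => //=; exact: cvg_cst.
by apply; exact: open_nbhs_nbhs.
Qed.

Let tphi := tangent phi.

Let is_diff_partial w : is_diff u0 (partial w)
  (fun v => 'd tphi ((u0, y0), (0, w)) ((v, 0), (0, 0))).
Proof.
apply: (near_eq_is_diff (f := tphi \o (fun u => ((u, y0), (0, w))))).
  by apply: filterS nearU => u Uu; rewrite /partial (diff_val (is_diff_def := partialE Uu)).
have dpair : is_diff u0 (fun u => ((u, y0), (0, w)) : (E * F) * (E * F))
    (fun v => ((v, 0), (0, 0))).
  have := is_diff_pair (is_diff_pair (is_diff_id u0) (is_diff_cst y0 u0))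
    (is_diff_cst ((0, w) : E * F) u0).
  exact.
have dt : differentiable tphi ((u0, y0), (0, w)).
  by have [_ [/= dt _]] := C2; exact: dt.
have := is_diff_comp dpair (differentiableP dt).
exact.
Qed.

Lemma mixed_partial_linear v : linear (fun w => 'd (partial w) u0 v).
Proof.
have dp w : differentiable (partial w) u0 by case: (is_diff_partial w).
move=> a w1 w2.
have -> : partial (a *: w1 + w2) = a *: partial w1 + partial w2.
  by apply/funext => u; rewrite /partial linearP.
have -> := diffD (differentiableZ a (dp w1)) (dp w2).
by congr (_ + _); exact: (congr1 (@^~ v) (diffZ a (dp w1))).
Qed.

Lemma mixed_partial_continuous v : continuous (fun w => 'd (partial w) u0 v).
Proof.
have -> : (fun w => 'd (partial w) u0 v) =
    tangent tphi \o (fun w => (((u0, y0), (0, w)), ((v, 0), (0, 0)))).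
  by apply/funext => w /=; rewrite (diff_val (is_diff_def := is_diff_partial w)).
move=> w; apply: continuous_comp; last by have [_ [_ /= +]] := C2; apply.
have dj : is_diff w (fun z => (((u0, y0), (0, z)), ((v, 0), (0, 0)))
      : (E * F) * (E * F) * ((E * F) * (E * F)))
    (fun z => ((0, (0, z)), 0)).
  have := is_diff_pair (is_diff_pair (is_diff_cst ((u0, y0) : E * F) w)
    (is_diff_pair (is_diff_cst (0 : E) w) (is_diff_id w)))
    (is_diff_cst (((v, 0), (0, 0)) : (E * F) * (E * F)) w).
  exact.
exact: differentiable_continuous (ex_diff (is_diff_def := dj)).
Qed.

Lemma mixed_partial_differentiable w : differentiable (partial w) u0.
Proof. by case: (is_diff_partial w). Qed.

End MixedPartial.

End Calculus.

(** * Tangent maps of maps between manifolds *)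

Section Manifolds.
Variable R : realType.

Definition has_tangent (E F : normedModType R) (M : chartedSpace E)
    (N : chartedSpace F) (f : M -> N) (x : M) (df : E -> F) : Prop :=
  {for x, continuous f} /\
  is_diff (fwd (chart_at x) x) (in_charts f x (f x)) df.

Section Charts.
Variables (E : normedModType R) (M : chartedSpace E).

Lemma bwdK (c : chart E M) v : (fwd c @` dom c) v -> fwd c (bwd c v) = v.
Proof. by move=> [x cx <-]; rewrite fwdK. Qed.

Lemma bwd_chart_at (x : M) : bwd (chart_at x) (fwd (chart_at x) x) = x.
Proof. exact/fwdK/chart_at_dom. Qed.

Lemma chart_at_cod (x : M) :
  (fwd (chart_at x) @` dom (chart_at x)) (fwd (chart_at x) x).
Proof. by exists x => //; exact: chart_at_dom. Qed.

Lemma near_bwdK (x : M) : \forall v \near fwd (chart_at x) x,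
  fwd (chart_at x) (bwd (chart_at x) v) = v.
Proof.
have : nbhs (fwd (chart_at x) x) (fwd (chart_at x) @` dom (chart_at x)).
  by apply: open_nbhs_nbhs; split; [exact: cod_open|exact: chart_at_cod].
by apply: filterS => v; exact: bwdK.
Qed.

Lemma near_bwd (x : M) (U : set M) : nbhs x U ->
  \forall v \near fwd (chart_at x) x, U (bwd (chart_at x) v).
Proof.
move=> xU; apply: (bwd_continuous (chart_at_cod x)).
by rewrite bwd_chart_at.
Qed.

End Charts.

Section Tangent.
Variables (E F K : normedModType R).
Variables (M : chartedSpace E) (N : chartedSpace F) (L : chartedSpace K).

Lemma tmapE (f : M -> N) x df : has_tangent f x df -> tmap f x = df.
Proof. by move=> [_ [_ <-]]. Qed.

Lemma tmap_linear (f : M -> N) x : linear (tmap f x).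
Proof. by move=> a u v; rewrite /tmap linearP. Qed.

Lemma has_tangentP (f : M -> N) x :
  mdifferentiable f x -> has_tangent f x (tmap f x).
Proof. by move=> [cf df]; split => //; exact: differentiableP. Qed.

Lemma has_tangent_mdifferentiable (f : M -> N) x df :
  has_tangent f x df -> mdifferentiable f x.
Proof. by move=> [cf []]. Qed.

Lemma has_tangent_continuous (f : M -> N) x df : has_tangent f x df -> continuous df.
Proof. by move=> [_ [fx <-]]; exact: diff_continuous. Qed.

Lemma near_comp_bwd (f : M -> N) x (U : set N) : {for x, continuous f} ->
  nbhs (f x) U -> \forall v \near fwd (chart_at x) x, U (f (bwd (chart_at x) v)).
Proof. by move=> cf fxU; apply: (near_bwd (U := f @^-1` U)); exact: cf. Qed.

Lemma has_tangent_comp (f : M -> N) (g : N -> L) x df dg :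
  has_tangent f x df -> has_tangent g (f x) dg ->
  has_tangent (g \o f) x (dg \o df).
Proof.
move=> [cf Df] [cg Dg]; split; first exact: continuous_comp.
have fx : in_charts f x (f x) (fwd (chart_at x) x) = fwd (chart_at (f x)) (f x).
  by rewrite /in_charts/= bwd_chart_at.
have Dg' : is_diff (in_charts f x (f x) (fwd (chart_at x) x))
  (in_charts g (f x) (g (f x))) dg by rewrite fx.
apply: near_eq_is_diff (is_diff_comp Df Dg').
have : nbhs (f x) (dom (chart_at (f x))).
  by apply: open_nbhs_nbhs; split; [exact: dom_open|exact: chart_at_dom].
move=> /(near_comp_bwd cf); apply: filterS => v fv.
by rewrite /in_charts/= fwdK.
Qed.

Lemma has_tangent_id (x : M) : has_tangent (@id M) x id.
Proof.
split; first by move=> A.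
apply: near_eq_is_diff (is_diff_id _).
by apply: filterS (near_bwdK x) => v; rewrite /in_charts/=.
Qed.

Lemma has_tangent_cst (y : N) (x : M) : has_tangent (fun _ : M => y) x (fun _ => 0).
Proof.
split; first exact: cst_continuous.
exact: (is_diff_cst (fwd (chart_at y) y)).
Qed.

Lemma has_tangent_pair (f : M -> N) (g : M -> L) x df dg :
  has_tangent f x df -> has_tangent g x dg ->
  has_tangent (N := prod_space N L) (fun y => (f y, g y)) x (fun v => (df v, dg v)).
Proof.
move=> [cf Df] [cg Dg]; split; first by apply: cvg_pair; [exact: cf|exact: cg].
exact: (is_diff_pair Df Dg).
Qed.

Lemma smooth_mdifferentiable (f : M -> N) :
  smooth_map f -> forall x, mdifferentiable f x.
Proof.
move=> [cf sf] x; split; first exact: cf.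
have [+ _] := sf x (f x) 1%N; apply.
by exists x => //; split; exact: chart_at_dom.
Qed.

Lemma has_tangent_eq (f g : M -> N) x df :
  f =1 g -> has_tangent f x df -> has_tangent g x df.
Proof. by move=> /funext ->. Qed.

End Tangent.

Section Product.
Variables (E F : normedModType R) (M : chartedSpace E) (N : chartedSpace F).

Lemma has_tangent_fst (p : prod_space M N) :
  has_tangent (M := prod_space M N) (N := M) fst p fst.
Proof.
split; first exact: cvg_fst.
have dfst : is_diff (fwd (chart_at p) p) (@fst E F) fst.
  have cf : continuous (@fst E F) by move=> ?; exact: cvg_fst.
  by split; [exact: linear_differentiable|rewrite diff_lin].
apply: near_eq_is_diff dfst.
by apply: filterS (near_bwdK p) => -[u v] []; rewrite /in_charts/= => ->.
Qed.

Lemma has_tangent_snd (p : prod_space M N) :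
  has_tangent (M := prod_space M N) (N := N) snd p snd.
Proof.
split; first exact: cvg_snd.
have dsnd : is_diff (fwd (chart_at p) p) (@snd E F) snd.
  have cf : continuous (@snd E F) by move=> ?; exact: cvg_snd.
  by split; [exact: linear_differentiable|rewrite diff_lin].
apply: near_eq_is_diff dsnd.
by apply: filterS (near_bwdK p) => -[u v] []; rewrite /in_charts/= => _ ->.
Qed.

End Product.

Lemma has_tangent_linear (E F : normedModType R) (f : {linear E -> F}) (x : E) :
  continuous f -> has_tangent (M := vect E) (N := vect F) f x f.
Proof.
move=> cf; split; first exact: cf.
by split; [exact: (linear_differentiable (f := f))|exact: (diff_lin (f := f))].
Qed.

Section SmoothAt.

Definition smooth_at n (E F : normedModType R) (M : chartedSpace E)
    (N : chartedSpace F) (f : M -> N) (x : M) : Prop :=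
  {for x, continuous f} /\
  Cn_at n (in_charts f x (f x)) (fwd (chart_at x) x).

Variables (E F K : normedModType R).
Variables (M : chartedSpace E) (N : chartedSpace F) (L : chartedSpace K).
Variable n : nat.

Lemma smooth_map_at (f : M -> N) : smooth_map f -> forall x, smooth_at n f x.
Proof.
move=> [cf sf] x; split; first exact: cf.
eexists; split; last exact: (sf x (f x) n); last first.
  by exists x => //; split; exact: chart_at_dom.
set c := chart_at x; set U := f @^-1` _.
have -> : fwd c @` (dom c `&` U) = (fwd c @` dom c) `&` bwd c @^-1` U.
  apply/seteqP; split=> [_ [y [cy Uy] <-]|v [[y cy <-]]].
    by split; [exists y|rewrite /preimage/= fwdK].
  by rewrite /preimage/= fwdK// => Uy; exists y.
apply: open_preimage_within; [exact: cod_open| |exact: bwd_continuous].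
by apply: open_comp => [y _|]; [exact: cf|exact: dom_open].
Qed.

Lemma smooth_at_comp (f : M -> N) (g : N -> L) x :
  smooth_at n f x -> smooth_at n g (f x) -> smooth_at n (g \o f) x.
Proof.
move=> [cf Df] [cg Dg]; split; first exact: continuous_comp.
have fx : in_charts f x (f x) (fwd (chart_at x) x) = fwd (chart_at (f x)) (f x).
  by rewrite /in_charts/= bwd_chart_at.
rewrite -fx in Dg.
apply: Cn_at_near (Cn_at_comp Df Dg).
have : nbhs (f x) (dom (chart_at (f x))).
  by apply: open_nbhs_nbhs; split; [exact: dom_open|exact: chart_at_dom].
move=> /(near_comp_bwd cf); apply: filterS => v fv.
by rewrite /in_charts/= fwdK.
Qed.

Lemma smooth_at_pair (f : M -> N) (g : M -> L) x :
  smooth_at n f x -> smooth_at n g x ->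
  smooth_at n (N := prod_space N L) (fun y => (f y, g y)) x.
Proof.
move=> [cf Df] [cg Dg]; split; first by apply: cvg_pair; [exact: cf|exact: cg].
exact: (Cn_at_pair Df Dg).
Qed.

Lemma smooth_at_fst (p : prod_space M N) :
  smooth_at n (M := prod_space M N) (N := M) fst p.
Proof.
split; first exact: cvg_fst.
have cf : continuous (@fst E F) by move=> ?; exact: cvg_fst.
apply: Cn_at_near (Cn_at_linear n (fwd (chart_at p) p) cf).
by apply: filterS (near_bwdK p) => -[u v] []; rewrite /in_charts/= => ->.
Qed.

Lemma smooth_at_snd (p : prod_space M N) :
  smooth_at n (M := prod_space M N) (N := N) snd p.
Proof.
split; first exact: cvg_snd.
have cf : continuous (@snd E F) by move=> ?; exact: cvg_snd.
apply: Cn_at_near (Cn_at_linear n (fwd (chart_at p) p) cf).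
by apply: filterS (near_bwdK p) => -[u v] []; rewrite /in_charts/= => _ ->.
Qed.

End SmoothAt.

Section Inner.
Variables (E F K : normedModType R).
Variables (M : chartedSpace E) (N : chartedSpace F) (L : chartedSpace K).
Variables (Phi : M -> N -> L) (a : M) (b : N).
Hypothesis Phib : forall x, Phi x b = Phi a b.
Hypothesis sPhi :
  smooth_at 2 (M := prod_space M N) (fun p : M * N => Phi p.1 p.2) (a, b).

Let phi (p : E * F) : K :=
  fwd (chart_at (Phi a b)) (Phi (bwd (chart_at a) p.1) (bwd (chart_at b) p.2)).

Let C2 : Cn_at 2 phi (fwd (chart_at a) a, fwd (chart_at b) b).
Proof. by case: sPhi. Qed.

Let innerE w : in_charts (N := vect K) (fun x => tmap (Phi x) b w) a
    (tmap (Phi a) b w) =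
  (fun u => 'd (fun y => phi (u, y)) (fwd (chart_at b) b) w).
Proof. by apply/funext => u; rewrite /in_charts/= /tmap /in_charts (Phib (bwd _ u)). Qed.

Lemma inner_tmap_linear v :
  linear (fun w => tmap (N := vect K) (fun x => tmap (Phi x) b w) a v).
Proof.
move=> k w1 w2; rewrite /tmap !innerE.
have [U [oU Uab CU]] := C2.
exact: (mixed_partial_linear oU Uab CU v k w1 w2).
Qed.

Lemma inner_tmap_continuous v :
  continuous (fun w => tmap (N := vect K) (fun x => tmap (Phi x) b w) a v).
Proof.
have -> : (fun w => tmap (N := vect K) (fun x => tmap (Phi x) b w) a v) =
  (fun w => 'd (fun u => 'd (fun y => phi (u, y)) (fwd (chart_at b) b) w)
    (fwd (chart_at a) a) v).
  by apply/funext => w; rewrite {1}/tmap innerE.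
have [U [oU Uab CU]] := C2.
exact: (mixed_partial_continuous oU Uab CU (v := v)).
Qed.

Lemma inner_tmap_continuousl w :
  continuous (tmap (N := vect K) (fun x => tmap (Phi x) b w) a).
Proof.
rewrite /tmap innerE; apply: diff_continuous.
have [U [oU Uab CU]] := C2.
exact: (mixed_partial_differentiable oU Uab CU w).
Qed.

End Inner.

End Manifolds.

(** * Lie groups and matched pairs *)

Section Functionals.
Variables (R : realType).
Implicit Types E F : normedModType R.

Lemma functionalK E (m : cdual E) : functional m = m.
Proof.
by apply: val_inj; exact: functionalE (@cdual_linear _ _ m) (@cdual_continuous _ _ m).
Qed.

Lemma functional_compE E F (L : E -> F) (m : cdual F) x :
  linear L -> continuous L -> functional (fun y => m (L y)) x = m (L x).
Proof.
move=> lL cL; rewrite functionalE// => [a u v|y]; first by rewrite lL linearP.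
by apply: (continuous_comp (f := L) (g := m)); [exact: cL|exact: cdual_continuous].
Qed.

End Functionals.

Lemma tmap_linearD (R : realType) (E F : normedModType R) (M : chartedSpace E)
    (N : chartedSpace F) (f : M -> N) x : {morph tmap f x : u v / u + v}.
Proof. by move=> u v; rewrite /tmap linearD. Qed.

Section TangentProduct.
Variables (R : realType) (E F K : normedModType R).
Variables (M : chartedSpace E) (N : chartedSpace F) (L : chartedSpace K).

Lemma has_tangent_left (f : prod_space M N -> L) x y df :
  has_tangent f (x, y) df -> has_tangent (fun z => f (z, y)) x (fun v => df (v, 0)).
Proof.
move=> Df; have := has_tangent_pair (has_tangent_id x) (has_tangent_cst (N := N) y x).
by move=> /has_tangent_comp; apply.
Qed.

Lemma has_tangent_right (f : prod_space M N -> L) x y df :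
  has_tangent f (x, y) df -> has_tangent (fun z => f (x, z)) y (fun v => df (0, v)).
Proof.
move=> Df; have := has_tangent_pair (has_tangent_cst (N := M) x y) (has_tangent_id y).
by move=> /has_tangent_comp; apply.
Qed.

Lemma tmap_cancel (f : M -> N) (g : N -> M) x :
  mdifferentiable f x -> mdifferentiable g (f x) -> cancel f g ->
  cancel (tmap f x) (tmap g (f x)).
Proof.
move=> /has_tangentP Df /has_tangentP Dg fgK v.
have /tmapE e := has_tangent_comp Df Dg.
have /tmapE := has_tangent_eq (fun z => esym (fgK z)) (has_tangent_id x).
by rewrite [tmap _ _]e => /(congr1 (@^~ v)).
Qed.

End TangentProduct.

Section Diffeomorphism.
Variables (R : realType) (E F : normedModType R).
Variables (M : chartedSpace E) (N : chartedSpace F).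

Lemma tmap_bij (f : M -> N) (g : N -> M) x :
  (forall z, mdifferentiable f z) -> (forall z, mdifferentiable g z) ->
  cancel f g -> cancel g f -> bijective (tmap f x).
Proof.
move=> Df Dg fgK gfK; exists (tmap g (f x)); first exact: tmap_cancel.
by have := tmap_cancel (Dg (f x)) (Df _) gfK; rewrite fgK.
Qed.

End Diffeomorphism.

Section LieGroup.
Variables (R : realType) (E : normedModType R) (G : lieGroup E).

Lemma has_tangent_mulr (g x : G) : has_tangent (M := G) (N := G)
  (fun y : G => (y * g)%g) x (tmap (M := G) (N := G) (fun y : G => (y * g)%g) x).
Proof.
have := has_tangent_left
  (has_tangentP (smooth_mdifferentiable (@lg_mul_smooth _ _ G) (x, g))).
by move=> D; have := D; rewrite -(tmapE D).
Qed.

Lemma TR_linear (g : G) : linear (TR g).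
Proof. exact: tmap_linear. Qed.

Lemma TR_continuous (g : G) : continuous (TR g).
Proof. exact: has_tangent_continuous (has_tangent_mulr g _). Qed.

Lemma TR_bij (g : G) : bijective (TR g).
Proof.
apply: (tmap_bij (M := G) (N := G) (g := fun y : G => (y * g^-1)%g)).
- by move=> z; exact: has_tangent_mdifferentiable (has_tangent_mulr _ _).
- by move=> z; exact: has_tangent_mdifferentiable (has_tangent_mulr _ _).
- exact: mulgK.
- exact: mulgVK.
Qed.

Lemma tmap_mul1l (g : G) (u v : E) :
  tmap (M := prod_space G G) (N := G) (fun p : G * G => (p.1 * p.2)%g) (1%g, g) (u, v) =
  TR g u + v.
Proof.
have D := has_tangentP (smooth_mdifferentiable (@lg_mul_smooth _ _ G) (1%g, g)).
have -> : (u, v) = (u, 0) + (0, v) :> E * E by congr (_, _); rewrite ?addr0 ?add0r.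
rewrite tmap_linearD.
have /tmapE e1 := has_tangent_left D.
have Dr := has_tangent_right D.
have /tmapE e2 := has_tangent_eq (M := G) (N := G) (fun z : G => mul1g z) Dr.
have /tmapE e3 := has_tangent_id (M := G) g.
have := congr1 (@^~ v) e2; rewrite e3 => <-.
by have := congr1 (@^~ u) e1; rewrite /TR => ->.
Qed.

Let conj (k x : G) : G := (k * x * k^-1)%g.

Let conj_smooth : smooth_at 2 (M := prod_space G G) (N := G)
  (fun p : G * G => conj p.1 p.2) (1%g, 1%g).
Proof.
have mul := smooth_map_at 2 (@lg_mul_smooth _ _ G).
have inv := smooth_map_at 2 (@lg_inv_smooth _ _ G).
have fst p := smooth_at_fst (M := G) (N := G) 2 p.
have := smooth_at_comp (smooth_at_pair (mul (1%g, 1%g))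
  (smooth_at_comp (fst (1%g, 1%g)) (inv _))) (mul _).
exact.
Qed.

Let conj1 (k : G) : conj k 1%g = conj 1%g 1%g.
Proof. by rewrite /conj !mulg1 !mulgV. Qed.

Lemma lie_bracket_linear (xi : E) : linear (lie_bracket G xi).
Proof.
by have := inner_tmap_linear (M := G) (N := G) (L := G) conj1 conj_smooth xi.
Qed.

Lemma lie_bracket_continuous (xi : E) : continuous (lie_bracket G xi).
Proof.
by have := inner_tmap_continuous (M := G) (N := G) (L := G)
  conj1 conj_smooth (v := xi).
Qed.

End LieGroup.

Section MatchedPair.
Variables (R : realType) (E F : normedModType R).
Variables (G : lieGroup E) (H : lieGroup F) (P : matchedPair G H).

Lemma has_tangent_lactl (g : G) (h : H) : has_tangent (M := H) (N := G)
  (fun y : H => lact P y g) h (tmap (M := H) (N := G) (fun y : H => lact P y g) h).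
Proof.
have := has_tangent_left (has_tangentP (smooth_mdifferentiable (lact_smooth P) (h, g))).
by move=> D; have := D; rewrite -(tmapE D).
Qed.

Lemma has_tangent_ractl (g : G) (h : H) : has_tangent (M := H) (N := H)
  (fun y : H => ract P y g) h (tmap (M := H) (N := H) (fun y : H => ract P y g) h).
Proof.
have := has_tangent_left (has_tangentP (smooth_mdifferentiable (ract_smooth P) (h, g))).
by move=> D; have := D; rewrite -(tmapE D).
Qed.

Lemma alg_lact_grp_linear g : linear ((alg_lact_grp P)^~ g).
Proof. exact: tmap_linear. Qed.

Lemma alg_lact_grp_continuous g : continuous ((alg_lact_grp P)^~ g).
Proof. exact: has_tangent_continuous (has_tangent_lactl g _). Qed.

Lemma alg_ract_grp_linear g : linear ((alg_ract_grp P)^~ g).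
Proof. exact: tmap_linear. Qed.

Lemma alg_ract_grp_continuous g : continuous ((alg_ract_grp P)^~ g).
Proof. exact: has_tangent_continuous (has_tangent_ractl g _). Qed.

Lemma alg_ract_grp_bij g : bijective ((alg_ract_grp P)^~ g).
Proof.
apply: (tmap_bij (M := H) (N := H) (g := fun y : H => ract P y g^-1%g)).
- by move=> z; exact: has_tangent_mdifferentiable (has_tangent_ractl _ _).
- by move=> z; exact: has_tangent_mdifferentiable (has_tangent_ractl _ _).
- by move=> z; rewrite -ractM mulgV ract1.
- by move=> z; rewrite -ractM mulVg ract1.
Qed.

Let lact_id1 (h : H) : lact P h 1%g = lact P 1%g 1%g.
Proof. by rewrite !lact_id. Qed.

Let ract_id1 (g : G) : ract P 1%g g = ract P 1%g 1%g.
Proof. by rewrite !ract_id. Qed.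

Let lact_smooth1 := smooth_map_at 2 (lact_smooth P) (1%g, 1%g).

Let ract_smooth1 : smooth_at 2 (M := prod_space G H) (N := H)
  (fun p : G * H => ract P p.2 p.1) (1%g, 1%g).
Proof.
have := smooth_at_comp (smooth_at_pair
  (smooth_at_snd (M := G) (N := H) 2 (1%g, 1%g))
  (smooth_at_fst (M := G) (N := H) 2 (1%g, 1%g)))
  (smooth_map_at 2 (ract_smooth P) _).
exact.
Qed.

Lemma alg_lact_alg_linearl xi : linear ((alg_lact_alg P)^~ xi).
Proof. exact: tmap_linear. Qed.

Lemma alg_lact_alg_continuousl xi : continuous ((alg_lact_alg P)^~ xi).
Proof.
by have := inner_tmap_continuousl (M := H) (N := G) (L := G)
  lact_id1 lact_smooth1 (w := xi).
Qed.

Lemma alg_lact_alg_linearr eta : linear (alg_lact_alg P eta).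
Proof.
by have := inner_tmap_linear (M := H) (N := G) (L := G)
  lact_id1 lact_smooth1 eta.
Qed.

Lemma alg_lact_alg_continuousr eta : continuous (alg_lact_alg P eta).
Proof.
by have := inner_tmap_continuous (M := H) (N := G) (L := G)
  lact_id1 lact_smooth1 (v := eta).
Qed.

Lemma alg_ract_alg_linearl xi : linear ((alg_ract_alg P)^~ xi).
Proof. by have := inner_tmap_linear (M := G) (N := H) (L := H)
  (Phi := fun g h => ract P h g) ract_id1 ract_smooth1 xi. Qed.

Lemma alg_ract_alg_continuousl xi : continuous ((alg_ract_alg P)^~ xi).
Proof. by have := inner_tmap_continuous (M := G) (N := H) (L := H)
  (Phi := fun g h => ract P h g) ract_id1 ract_smooth1 (v := xi). Qed.

Lemma alg_ract_alg_linearr eta : linear (alg_ract_alg P eta).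
Proof. exact: tmap_linear. Qed.

Lemma alg_ract_alg_continuousr eta : continuous (alg_ract_alg P eta).
Proof. by have := inner_tmap_continuousl (M := G) (N := H) (L := H)
  (Phi := fun g h => ract P h g) ract_id1 ract_smooth1 (w := eta). Qed.

Lemma mp_TRE (g : G) (h : H) (x : E * F) :
  mp_TR P (g, h) x =
  (TR g x.1 + alg_lact_grp P x.2 g, TR h (alg_ract_grp P x.2 g)).
Proof.
pose one : mp_space G H := (1%g, 1%g).
have Dlact : has_tangent (M := mp_space G H) (N := G)
    (fun l : G * H => lact P l.2 g) one (fun v => alg_lact_grp P v.2 g).
  exact: has_tangent_comp (has_tangent_snd one) (has_tangent_lactl g 1%g).
have D1 : has_tangent (M := mp_space G H) (N := G)
    (fun l : G * H => l.1 * lact P l.2 g)%g one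
    (fun v => TR g v.1 + alg_lact_grp P v.2 g).
  have := has_tangent_comp (has_tangent_pair (has_tangent_fst one) Dlact)
    (has_tangentP (smooth_mdifferentiable (@lg_mul_smooth _ _ G) _)).
  rewrite {2}/one/= lact1; congr has_tangent.
  by apply/funext => v; rewrite -tmap_mul1l.
have D2 : has_tangent (M := mp_space G H) (N := H)
    (fun l : G * H => ract P l.2 g * h)%g one
    (fun v => TR h (alg_ract_grp P v.2 g)).
  have Dract := has_tangent_comp (has_tangent_snd one) (has_tangent_ractl g 1%g).
  have Dh := has_tangent_mulr h (ract P 1%g g).
  have := has_tangent_comp Dract Dh.
  by rewrite ract_id.
exact: (congr1 (@^~ x) (tmapE (has_tangent_pair D1 D2))).
Qed.

Lemma mp_TR_bij (k : G * H) : bijective (mp_TR P k).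
Proof.
case: k => g h.
have [TRg TgK TgK'] := TR_bij g; have [TRh ThK ThK'] := TR_bij h.
have [S SK SK'] := alg_ract_grp_bij g.
exists (fun y => (TRg (y.1 - alg_lact_grp P (S (TRh y.2)) g), S (TRh y.2))).
  by move=> [xi eta]; rewrite mp_TRE/= ThK SK addrK TgK.
by move=> [xi eta]; rewrite mp_TRE/= SK' ThK' TgK' subrK.
Qed.

End MatchedPair.

(** * Dual maps and the Hamiltonian vector field *)

Section DualOperations.
Variables (R : realType) (E : normedModType R).

Lemma cdualDE (m n : cdual E) x : (m + n) x = m x + n x.
Proof. by []. Qed.

Lemma cdualNE (m : cdual E) x : (- m) x = - m x.
Proof. by []. Qed.

End DualOperations.

Section Reflexive.
Variables (R : realType) (E : normedModType R).
Hypothesis reflE : is_reflexive E.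

Lemma of_bidualE (L : cdual (cdual E)) (m : cdual E) : m (of_bidual L) = L m.
Proof.
have [g gK Kg] := reflE.
have ex : [set x | bidual_eval x = L] !=set0 by exists (g L); exact: Kg.
by rewrite -bidual_evalE /of_bidual (xgetPex 0 ex).
Qed.

Lemma reflexive_separated (x y : E) : (forall m : cdual E, m x = m y) -> x = y.
Proof.
move=> xy; apply: (bij_inj reflE); apply: val_inj; apply/funext => m /=.
by rewrite !bidual_evalE.
Qed.

End Reflexive.

Section LieDuals.
Variables (R : realType) (E : normedModType R) (G : lieGroup E).

Lemma coTRE (g : G) (alpha : cdual E) xi : coTR g alpha xi = alpha (TR g xi).
Proof. by apply: functional_compE; [exact: TR_linear|exact: TR_continuous]. Qed.

Lemma ad_starE (xi : E) (mu : cdual E) zeta :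
  ad_star G xi mu zeta = - mu (lie_bracket G xi zeta).
Proof.
have := functional_compE (L := lie_bracket G xi) (- mu) zeta.
by apply; [exact: lie_bracket_linear|exact: lie_bracket_continuous].
Qed.

End LieDuals.

Section Duals.
Variables (R : realType) (E F : normedModType R).
Variables (G : lieGroup E) (H : lieGroup F) (P : matchedPair G H).

Lemma lact_starE (mu : cdual E) (eta : F) xi :
  lact_star P mu eta xi = mu (alg_lact_alg P eta xi).
Proof.
by apply: functional_compE; [exact: alg_lact_alg_linearr|exact: alg_lact_alg_continuousr].
Qed.

Lemma b_starE (xi : E) (mu : cdual E) eta :
  b_star P xi mu eta = mu (alg_lact_alg P eta xi).
Proof.
apply: (functional_compE (L := (alg_lact_alg P)^~ xi)).
  exact: alg_lact_alg_linearl.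
exact: alg_lact_alg_continuousl.
Qed.

Lemma ract_starE (xi : E) (nu : cdual F) eta :
  ract_star P xi nu eta = nu (alg_ract_alg P eta xi).
Proof.
apply: (functional_compE (L := (alg_ract_alg P)^~ xi)).
  exact: alg_ract_alg_linearl.
exact: alg_ract_alg_continuousl.
Qed.

Lemma a_starE (eta : F) (nu : cdual F) xi :
  a_star P eta nu xi = nu (alg_ract_alg P eta xi).
Proof.
by apply: functional_compE; [exact: alg_ract_alg_linearr|exact: alg_ract_alg_continuousr].
Qed.

Lemma grp_ract_starE (g : G) (nu : cdual F) eta :
  grp_ract_star P g nu eta = nu (alg_ract_grp P eta g).
Proof.
apply: (functional_compE (L := (alg_ract_grp P)^~ g)).
  exact: alg_ract_grp_linear.
exact: alg_ract_grp_continuous.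
Qed.

Lemma corhoE (g : G) (alpha : cdual E) eta :
  corho P g alpha eta = alpha (alg_lact_grp P eta g).
Proof.
apply: (functional_compE (L := (alg_lact_grp P)^~ g)).
  exact: alg_lact_grp_linear.
exact: alg_lact_grp_continuous.
Qed.

Let linear_at0 (V W : normedModType R) (f : V -> W) : linear f -> f 0 = 0.
Proof.
by move=> lf; have := lf (-1) 0 0; rewrite scaler0 addr0 scaleN1r addNr.
Qed.

Lemma mp_pairingE (mu : cdual E) (nu : cdual F) x :
  mp_pairing (mu, nu) x = mu x.1 + nu x.2.
Proof. by []. Qed.

Lemma mp_ad_starE x (m : cdual E * cdual F) :
  mp_ad_star P x m =
  (ad_star G x.1 m.1 - lact_star P m.1 x.2 - a_star P x.2 m.2,
   ad_star H x.2 m.2 + ract_star P x.1 m.2 + b_star P x.1 m.1).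
Proof.
have dE := (cdualDE, cdualNE).
rewrite /mp_ad_star /mp_functional; congr (_, _).
  rewrite -[RHS]functionalK; congr functional; apply/funext => xi.
  by rewrite mp_ad_star_left !dE ad_starE lact_starE a_starE.
rewrite -[RHS]functionalK; congr functional; apply/funext => eta.
rewrite !dE ad_starE ract_starE b_starE /mp_pairing /mp_bracket /=.
rewrite (linear_at0 (lie_bracket_linear G _)) (linear_at0 (alg_lact_alg_linearr P _)).
rewrite (linear_at0 (alg_ract_alg_linearr P _)) !addr0 sub0r.
by rewrite (linearN m.1) (linearB m.2) /=; ring.
Qed.

Lemma mp_pairing_ad_star x (m : cdual E * cdual F) y :
  mp_pairing (mp_ad_star P x m) y = - mp_pairing m (mp_bracket P x y).
Proof.
rewrite mp_ad_starE mp_pairingE !cdualDE !cdualNE.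
rewrite !ad_starE lact_starE a_starE ract_starE b_starE /mp_pairing /mp_bracket /=.
by rewrite !(linearB m.1) !(linearB m.2) !(linearD m.1) !(linearD m.2) /=; ring.
Qed.

End Duals.

Section Hamiltonian.
Variables (R : realType) (E F : normedModType R).
Variables (G : lieGroup E) (H : lieGroup F) (P : matchedPair G H).
Hypotheses (reflE : is_reflexive E) (reflF : is_reflexive F).

Section Differential.
Variable Ham : cotangent G H -> R^o.
Hypothesis smooth_Ham : smooth_map (M := cotangent G H) (N := vect R^o) Ham.
Variables (mu : cdual E) (nu : cdual F) (g : G) (h : H).

Let p : cotangent G H := ((mu, nu), (g, h)).
Let dHam : cotangent_vec E F -> R^o := tmap (N := vect R^o) Ham p.

Let DHam : has_tangent (N := vect R^o) Ham p dHam.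
Proof. exact/has_tangentP/smooth_mdifferentiable. Qed.

Let partial (V : normedModType R) (M : chartedSpace V) (j : M -> cotangent G H) x
    (dj : V -> cotangent_vec E F) v :
  j x = p -> has_tangent j x dj ->
  functional (tmap (N := vect R^o) (Ham \o j) x) v = dHam (dj v).
Proof.
move=> jx Dj; have D : has_tangent (N := vect R^o) Ham (j x) dHam by rewrite jx.
have DH := has_tangent_comp Dj D.
rewrite functionalE.
- by rewrite (tmapE DH).
- exact: tmap_linear.
- by rewrite (tmapE DH); exact: has_tangent_continuous DH.
Qed.

Lemma d_muE (m : cdual E) : m (d_mu Ham mu nu g h) = dHam ((m, 0), (0, 0)).
Proof.
rewrite of_bidualE//.
apply: (partial (M := vect (cdual E)) (j := fun m => ((m, nu), (g, h)))
  (dj := fun m => ((m, 0), (0, 0)))) => //.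
apply: has_tangent_pair (has_tangent_cst ((g, h) : mp_space G H) _).
have := has_tangent_pair (has_tangent_id (M := vect (cdual E)) mu)
  (has_tangent_cst (M := vect (cdual E)) (N := vect (cdual F)) nu mu).
exact.
Qed.

Lemma d_nuE (m : cdual F) : m (d_nu Ham mu nu g h) = dHam ((0, m), (0, 0)).
Proof.
rewrite of_bidualE//.
apply: (partial (M := vect (cdual F)) (j := fun m => ((mu, m), (g, h)))
  (dj := fun m => ((0, m), (0, 0)))) => //.
apply: has_tangent_pair (has_tangent_cst ((g, h) : mp_space G H) _).
have := has_tangent_pair (has_tangent_cst (M := vect (cdual F)) (N := vect (cdual E)) mu nu)
  (has_tangent_id (M := vect (cdual F)) nu).
exact.
Qed.

Lemma d_gE (xi : E) : d_g Ham mu nu g h xi = dHam ((0, 0), (xi, 0)).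
Proof.
apply: (partial (M := G) (j := fun x => ((mu, nu), (x, h)))
  (dj := fun xi => ((0, 0), (xi, 0)))) => //.
have := has_tangent_pair
  (has_tangent_cst (M := G) (N := vect (cdual E * cdual F)%type) (mu, nu) g)
  (has_tangent_pair (has_tangent_id (M := G) g) (has_tangent_cst (M := G) (N := H) h g)).
exact.
Qed.

Lemma d_hE (eta : F) : d_h Ham mu nu g h eta = dHam ((0, 0), (0, eta)).
Proof.
apply: (partial (M := H) (j := fun y => ((mu, nu), (g, y)))
  (dj := fun eta => ((0, 0), (0, eta)))) => //.
have := has_tangent_pair
  (has_tangent_cst (M := H) (N := vect (cdual E * cdual F)%type) (mu, nu) h)
  (has_tangent_pair (has_tangent_cst (M := H) (N := G) g h) (has_tangent_id (M := H) h)).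
exact.
Qed.

Lemma tmap_HamE (m : cdual E) (n : cdual F) (xi : E) (eta : F) :
  dHam ((m, n), (xi, eta)) =
  m (d_mu Ham mu nu g h) + n (d_nu Ham mu nu g h) +
  d_g Ham mu nu g h xi + d_h Ham mu nu g h eta.
Proof.
rewrite d_muE d_nuE d_gE d_hE /dHam -!tmap_linearD.
by congr (tmap _ _ _); congr (_, _); congr (_, _); rewrite /= ?addr0 ?add0r.
Qed.

End Differential.

End Hamiltonian.

Lemma mp_pairing_injl (R : realType) (E F : normedModType R)
    (m n : cdual E * cdual F) :
  (forall x, mp_pairing m x = mp_pairing n x) -> m = n.
Proof.
case: m n => [m1 m2] [n1 n2] mn; congr (_, _); apply: val_inj; apply/funext => x.
  by have := mn (x, 0); rewrite !mp_pairingE /= !linear0 !addr0.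
by have := mn (0, x); rewrite !mp_pairingE /= !linear0 !add0r.
Qed.

Lemma mp_pairing_injr (R : realType) (E F : normedModType R) (x y : E * F) :
  is_reflexive E -> is_reflexive F ->
  (forall m, mp_pairing m x = mp_pairing m y) -> x = y.
Proof.
move=> reflE reflF; case: x y => [x1 x2] [y1 y2] xy.
congr (_, _); apply: reflexive_separated => // n.
  by have := xy (n, 0); rewrite !mp_pairingE /= !addr0.
by have := xy (0, n); rewrite !mp_pairingE /= !add0r.
Qed.

Section HamiltonianField.
Variables (R : realType) (E F : normedModType R).
Variables (G : lieGroup E) (H : lieGroup F) (P : matchedPair G H).
Hypotheses (reflE : is_reflexive E) (reflF : is_reflexive F).
Variable Omega : cotangent G H -> cotangent_vec E F -> cotangent_vec E F -> R.
Hypothesis canonical_Omega : canonical_symplectic P Omega.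

(* The antisymmetry of the bracket, up to pairing, is inherited from that of
   [Omega]; no symmetry of second derivatives is used. *)
Lemma mp_pairing_bracketC (p : cotangent G H) x y :
  mp_pairing p.1 (mp_bracket P x y) = - mp_pairing p.1 (mp_bracket P y x).
Proof.
have [two OmegaE] := canonical_Omega.
have [addr addl alt] := two p.
pose A := right_invariant_field P 0 x p; pose B := right_invariant_field P 0 y p.
have := alt (A + B).
have := addl (A + B) 1 A B; rewrite !scale1r => ->.
have := addr A 1 A B; rewrite !scale1r => ->.
have := addr B 1 A B; rewrite !scale1r => ->.
rewrite !alt addr0 add0r !OmegaE /mp_pairing /= => /eqP.
by rewrite !subrr !add0r addr_eq0 => /eqP.
Qed.

Variable Ham : cotangent G H -> R^o.
Hypothesis smooth_Ham : smooth_map (M := cotangent G H) (N := vect R^o) Ham.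

Definition ham_algebra (p : cotangent G H) : E * F :=
  (d_mu Ham p.1.1 p.1.2 p.2.1 p.2.2, d_nu Ham p.1.1 p.1.2 p.2.1 p.2.2).

Definition ham_momentum (p : cotangent G H) : cdual E * cdual F :=
  (- coTR p.2.1 (d_g Ham p.1.1 p.1.2 p.2.1 p.2.2),
   - corho P p.2.1 (d_g Ham p.1.1 p.1.2 p.2.1 p.2.2)
   - grp_ract_star P p.2.1 (coTR p.2.2 (d_h Ham p.1.1 p.1.2 p.2.1 p.2.2))).

Definition ham_field (p : cotangent G H) : cotangent_vec E F :=
  right_invariant_field P (ham_momentum p) (ham_algebra p) p.

Lemma dHam_right_invariant (p : cotangent G H) m x :
  tmap (N := vect R^o) Ham p (right_invariant_field P m x p) =
  mp_pairing m (ham_algebra p) - mp_pairing (ham_momentum p) x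
  + mp_pairing p.1 (mp_bracket P (ham_algebra p) x).
Proof.
rewrite mp_pairing_bracketC -mp_pairing_ad_star.
case: p => [[mu nu] [g h]]; rewrite /right_invariant_field /ham_momentum /=.
set n := mp_ad_star _ _ _; case: m n => [m1 m2] [n1 n2].
rewrite mp_TRE tmap_HamE// !mp_pairingE !cdualDE !cdualNE.
rewrite !(linearD (d_g _ _ _ _ _)) coTRE corhoE grp_ract_starE coTRE /mp_pairing /=.
by ring.
Qed.

Lemma right_invariant_surj (p : cotangent G H) (v : cotangent_vec E F) :
  exists m x, v = right_invariant_field P m x p.
Proof.
have [T TK KT] := mp_TR_bij P p.2.
exists (v.1 - mp_ad_star P (T v.2) p.1), (T v.2).
by case: v => v1 v2; rewrite /right_invariant_field /= subrK KT.
Qed.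

Lemma hamiltonian_vectorP (p : cotangent G H) w :
  (forall v, Omega p w v = tmap (N := vect R^o) Ham p v) <-> w = ham_field p.
Proof.
have [_ OmegaE] := canonical_Omega.
split=> [Hw|-> v]; last first.
  by have [m [x ->]] := right_invariant_surj p v; rewrite OmegaE dHam_right_invariant.
have [m [x wE]] := right_invariant_surj p w.
have eqn n y : mp_pairing n x - mp_pairing m y + mp_pairing p.1 (mp_bracket P x y) =
    mp_pairing n (ham_algebra p) - mp_pairing (ham_momentum p) y
    + mp_pairing p.1 (mp_bracket P (ham_algebra p) y).
  by rewrite -OmegaE -wE Hw dHam_right_invariant.
have pair0 y : mp_pairing (0 : cdual E * cdual F) y = 0 by rewrite /mp_pairing /= addr0.
have xE : x = ham_algebra p.
  apply: mp_pairing_injr => // n.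
  have := eqn n 0; have := eqn 0 0; rewrite !pair0 !sub0r => e1 e2.
  by apply/eqP; rewrite -subr_eq0; apply/eqP; move: e1 e2; lra.
have mE : m = ham_momentum p.
  apply: mp_pairing_injl => y.
  by have := eqn 0 y; rewrite xE => /addIr; rewrite !pair0 !sub0r => /oppr_inj.
by rewrite wE mE xE.
Qed.

Lemma hamiltonian_fieldP X : hamiltonian_field Ham Omega X <-> X = ham_field.
Proof.
split=> [HX|-> p]; last exact/hamiltonian_vectorP.
by apply/funext => p; apply/hamiltonian_vectorP/HX.
Qed.

Lemma ham_fieldE mu nu g h :
  let dmu := d_mu Ham mu nu g h in let dnu := d_nu Ham mu nu g h in
  let dg := d_g Ham mu nu g h in let dh := d_h Ham mu nu g h in
  ham_field ((mu, nu), (g, h)) =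
  ((- coTR g dg + ad_star G dmu mu - lact_star P mu dnu - a_star P dnu nu,
    - corho P g dg - grp_ract_star P g (coTR h dh)
    + ad_star H dnu nu + ract_star P dmu nu + b_star P dmu mu),
   (TR g dmu + alg_lact_grp P dnu g, TR h (alg_ract_grp P dnu g))).
Proof.
rewrite /ham_field /right_invariant_field mp_ad_starE mp_TRE /=.
by congr (_, _); congr (_, _); rewrite !addrA.
Qed.

End HamiltonianField.

Lemma velocity_cotangent (R : realType) (E F : normedModType R)
    (G : lieGroup E) (H : lieGroup F)
    (mu : R -> cdual E) (nu : R -> cdual F) (g : R -> G) (h : R -> H) (t : R) :
  let c : R^o -> cotangent G H := fun t => ((mu t, nu t), (g t, h t)) in
  differentiable_curve c t ->
  velocity c t =
  ((velocity (M := vect (cdual E)) mu t, velocity (M := vect (cdual F)) nu t),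
   (velocity (M := G) g t, velocity (M := H) h t)).
Proof.
move=> c /has_tangentP Dc.
have Dm := has_tangent_comp Dc (has_tangent_fst _).
have Dk := has_tangent_comp Dc (has_tangent_snd _).
have cfst : continuous (@fst (cdual E) (cdual F)) by move=> ?; exact: cvg_fst.
have csnd : continuous (@snd (cdual E) (cdual F)) by move=> ?; exact: cvg_snd.
have Dmu := has_tangent_comp Dm (has_tangent_linear _ cfst).
have Dnu := has_tangent_comp Dm (has_tangent_linear _ csnd).
have Dg := has_tangent_comp Dk (has_tangent_fst _).
have Dh := has_tangent_comp Dk (has_tangent_snd _).
rewrite /velocity [in RHS](tmapE Dmu) [in RHS](tmapE Dnu).
rewrite [in RHS](tmapE Dg) [in RHS](tmapE Dh) /=.
by case: (tmap _ _ _) => [[? ?] [? ?]].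
Qed.

Theorem proposition3p1 (R : realType) (E F : normedModType R)
    (G : lieGroup E) (H : lieGroup F) (P : matchedPair G H)
    (reflE : is_reflexive E) (reflF : is_reflexive F)
    (Omega : cotangent G H -> cotangent_vec E F -> cotangent_vec E F -> R)
    (canonical_Omega : canonical_symplectic P Omega)
    (Ham : cotangent G H -> R^o)
    (smooth_Ham : smooth_map (M := cotangent G H) (N := vect R^o) Ham) :
  (exists! X : cotangent G H -> cotangent_vec E F, hamiltonian_field Ham Omega X) /\
  forall X : cotangent G H -> cotangent_vec E F, hamiltonian_field Ham Omega X ->
  forall (I : set R) (mu : R -> cdual E) (nu : R -> cdual F) (g : R -> G) (h : R -> H),
  let c : R^o -> cotangent G H := fun t => ((mu t, nu t), (g t, h t)) in
  let dmu t := d_mu Ham (mu t) (nu t) (g t) (h t) in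
  let dnu t := d_nu Ham (mu t) (nu t) (g t) (h t) in
  let dg t := d_g Ham (mu t) (nu t) (g t) (h t) in
  let dh t := d_h Ham (mu t) (nu t) (g t) (h t) in
  open I ->
  (forall t, I t -> differentiable_curve c t) ->
  integral_curve X I c <->
  forall t, I t ->
    [/\ velocity (M := G) g t =
          TR (g t) (dmu t) + alg_lact_grp P (dnu t) (g t),
        velocity (M := H) h t =
          TR (h t) (alg_ract_grp P (dnu t) (g t)),
        velocity (M := vect (cdual E)) mu t =
          - coTR (g t) (dg t) + ad_star G (dmu t) (mu t)
          - lact_star P (mu t) (dnu t) - a_star P (dnu t) (nu t)
      & velocity (M := vect (cdual F)) nu t =
          - corho P (g t) (dg t) - grp_ract_star P (g t) (coTR (h t) (dh t))
          + ad_star H (dnu t) (nu t) + ract_star P (dmu t) (nu t)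
          + b_star P (dmu t) (mu t)].
Proof.
have fieldP := hamiltonian_fieldP reflE reflF canonical_Omega smooth_Ham.
split; first by exists (ham_field P Ham); split=> [|X /fieldP]; [exact/fieldP|].
move=> X /fieldP -> I mu nu g h c dmu dnu dg dh _ cI.
split=> cX t It.
  have [_] := cX t It; rewrite (velocity_cotangent (cI t It)) ham_fieldE.
  by move=> [-> -> -> ->].
split; first exact: cI.
rewrite (velocity_cotangent (cI t It)) ham_fieldE.
by have [-> -> -> ->] := cX t It.
Qed.
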